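(* Let $A\in\mathbb{R}^{n\times n}$, let the vector norm be the Euclidean norm, and let $j\in\{1,\dots,q\}$ be such that $\Lambda_j$ is single complex. For $u\in\mathbb{R}^n$ and $t\in\mathbb{R}$, $$\|\widehat\Theta_j(t,u)\|_2=\sqrt{\frac{1+V_j\cos(\Omega_j(t)+\Delta_j(u))}{2}} .$$
   Context: The spectrum of $A$ is partitioned by real parts into $\Lambda_1,\dots,\Lambda_q$, where $\Lambda_j$ contains all eigenvalues with real part $r_j$ and $r_1>\dots>r_q$. $\Lambda_j$ is single complex if it consists of a complex conjugate pair $\lambda_j,\overline{\lambda_j}$ of non-real eigenvalues, each having exactly one Jordan block of maximum order; $\lambda_j$ is the one with positive imaginary part $\omega_j>0$. Let $V$ be an invertible matrix whose columns form a Jordan basis for $A$ and $W=V^{-1}$. Let $v^{(j,1)},\dots,v^{(j,M_j)}$ (columns of $V$) be the unique longest Jordan chain for $\lambda_j$, with $v^{(j,1)}$ an eigenvector; put $v^{(j)}:=v^{(j,1)}$ and let $w^{(j)}$ be the row of $W$ whose index equals the column index of $v^{(j,M_j)}$ in $V$. The basis is chosen so that $\overline{v^{(j,1)}},\dots,\overline{v^{(j,M_j)}}$ are columns of $V$ forming the longest Jordan chain for $\overline{\lambda_j}$ and the row of $W$ corresponding to $\overline{v^{(j,M_j)}}$ is $\overline{w^{(j)}}$. Put $\widehat v^{(j)}:=v^{(j)}/\|v^{(j)}\|_2$, $\widehat w^{(j)}:=w^{(j)}/\|w^{(j)}\|_2$. Polar forms: $\widehat v^{(j)}_k=|\widehat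 v^{(j)}_k|\mathrm{e}^{\mathrm{i}\alpha_{jk}}$; $\widehat w^{(j)}u=|\widehat w^{(j)}u|\mathrm{e}^{\mathrm{i}\gamma_j(u)}$; $(\widehat v^{(j)})^T\widehat v^{(j)}=V_j\mathrm{e}^{\mathrm{i}\delta_j}$ with $V_j\ge0$ (transpose without conjugation); the angle of $0$ is any fixed real number. $\widehat\Theta_j(t,u):=\big(|\widehat v^{(j)}_k|\cos(\omega_jt+\alpha_{jk}+\gamma_j(u))\big)_{k=1,\dots,n}\in\mathbb{R}^n$. Let $R_j\in\mathbb{R}^{2\times n}$ have rows $\mathrm{Re}(\widehat w^{(j)})$ and $\mathrm{Im}(\widehat w^{(j)})$ and let $\alpha^{(j)}\in\mathbb{R}^2$ be a unit left singular vector of $R_j$ for its largest singular value; $\theta_j$ is the angle between the real axis and $\alpha^{(j)}$ (identifying $\mathbb{R}^2$ with $\mathbb{C}$). Then $\Omega_j(t):=2(\omega_jt+\theta_j)+\delta_j$ and $\Delta_j(u):=2(\gamma_j(u)-\theta_j)$. *)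

(* Defs.v *)
From HB Require Import structures.
From mathcomp Require Import all_boot all_order all_algebra.
From mathcomp Require Import complex.
From mathcomp Require Import reals trigo.

Set Implicit Arguments.
Unset Strict Implicit.
Unset Printing Implicit Defensive.

Import Order.TTheory GRing.Theory Num.Theory.
Local Open Scope ring_scope.
Local Open Scope complex_scope.

(* [`|z|] has type R[i]; this is the modulus as an element of R. *)
Definition modc (R : realType) (z : R[i]) : R := ComplexField.Normc.normc z.

Definition expi (R : realType) (a : R) : R[i] := cos a +i* sin a.

(* Every real number is an angle of 0. *)
Definition is_angle (R : realType) (z : R[i]) (a : R) : Prop :=
  z = (modc z)%:C * expi a.

Definition norm2 (R : realType) (m n : nat) (M : 'M[R]_(m, n)) : R :=
  Num.sqrt (\sum_i \sum_k M i k ^+ 2).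

Definition cnorm2 (R : realType) (m n : nat) (M : 'M[R[i]]_(m, n)) : R :=
  norm2 (map_mx (@modc R) M).

Definition normalize (R : realType) (m n : nat) (M : 'M[R[i]]_(m, n)) :
    'M[R[i]]_(m, n) :=
  ((cnorm2 M)^-1)%:C *: M.

Definition cmx (R : realType) (m n : nat) (M : 'M[R]_(m, n)) :
    'M[R[i]]_(m, n) :=
  map_mx (real_complex R) M.

Definition conjmx (R : realType) (m n : nat) (M : 'M[R[i]]_(m, n)) :
    'M[R[i]]_(m, n) :=
  map_mx (@conjc R) M.

Definition Lambda (R : realType) (n : nat) (A : 'M[R]_n) (x : R) :
    pred R[i] :=
  [pred l : R[i] | eigenvalue (cmx A) l && (complex.Re l == x)].

Definition real_parts (R : realType) (n q : nat) (A : 'M[R]_n)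
    (r : 'I_q -> R) : Prop :=
  (forall j k : 'I_q, (j < k)%N -> r k < r j) /\
  (forall x : R, (exists j, r j = x) <-> (exists l, l \in Lambda A x)).

(* Block diagonal with Jordan blocks, the 1's being on the superdiagonal. *)
Definition is_jordan_mx (R : realType) (n : nat) (J : 'M[R[i]]_n) : Prop :=
  forall i k : 'I_n,
    (k != i -> k != i.+1 :> nat -> J i k = 0) /\
    (k = i.+1 :> nat -> J i k = 0 \/ (J i k = 1 /\ J i i = J k k)).

Definition jordan_form (R : realType) (n : nat) (A : 'M[R]_n)
    (V : 'M[R[i]]_n) : 'M[R[i]]_n :=
  invmx V *m cmx A *m V.

Definition jordan_basis (R : realType) (n : nat) (A : 'M[R]_n)
    (V : 'M[R[i]]_n) : Prop :=
  V \in unitmx /\ is_jordan_mx (jordan_form A V).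

(* The indices a, ..., b (both included) are those of one (maximal) Jordan
   block of J, of order b - a + 1 and with eigenvalue l.  When J is
   [jordan_form A V], columns a, ..., b of V are then a Jordan chain for l,
   column a being the eigenvector. *)
Definition jordan_block (R : realType) (n : nat) (J : 'M[R[i]]_n) (l : R[i])
    (a b : 'I_n) : Prop :=
  [/\ (a <= b)%N,
      forall i : 'I_n, (a <= i <= b)%N -> J i i = l,
      forall i k : 'I_n, k = i.+1 :> nat -> (a <= i)%N -> (k <= b)%N ->
        J i k = 1,
      forall i : 'I_n, a = i.+1 :> nat -> J i a = 0
    & forall k : 'I_n, k = b.+1 :> nat -> J b k = 0].

Definition unique_longest_block (R : realType) (n : nat) (J : 'M[R[i]]_n)
    (l : R[i]) (a b : 'I_n) : Prop :=
  jordan_block J l a b /\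
  forall a' b' : 'I_n, jordan_block J l a' b' -> (a', b') <> (a, b) ->
    (b' - a' < b - a)%N.

(* Jordan forms exist and are unique up to the order of the blocks, so the
   choice of the Jordan basis V is immaterial. *)
Definition single_complex (R : realType) (n : nat) (A : 'M[R]_n) (x : R) :
    Prop :=
  exists l : R[i],
    [/\ 0 < complex.Im l,
        forall z : R[i], z \in Lambda A x <-> z = l \/ z = l^*
      & exists V : 'M[R[i]]_n,
        [/\ jordan_basis A V,
            exists a b, unique_longest_block (jordan_form A V) l a b
          & exists a b, unique_longest_block (jordan_form A V) l^* a b]].

(* The conjugates of columns a, ..., b of V are columns a', ..., b' of V and
   form the longest chain for l^*; the rows of V^-1 with indices b and b' are
   conjugate. *)
Definition conjugate_chain (R : realType) (n : nat) (A : 'M[R]_n)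
    (V : 'M[R[i]]_n) (l : R[i]) (a b : 'I_n) : Prop :=
  exists a' b' : 'I_n,
    [/\ unique_longest_block (jordan_form A V) l^* a' b',
        (b' - a' = b - a)%N,
        forall k k' : 'I_n, (a <= k <= b)%N -> (a' <= k' <= b')%N ->
          (k' - a' = k - a)%N -> col k' V = conjmx (col k V)
      & row b' (invmx V) = conjmx (row b (invmx V))].

Definition vhat (R : realType) (n : nat) (V : 'M[R[i]]_n) (a : 'I_n) :
    'cV[R[i]]_n :=
  normalize (col a V).

Definition what (R : realType) (n : nat) (V : 'M[R[i]]_n) (b : 'I_n) :
    'rV[R[i]]_n :=
  normalize (row b (invmx V)).

Definition re_im_rows (R : realType) (n : nat) (w : 'rV[R[i]]_n) :
    'M[R]_(2, n) :=
  \matrix_(i < 2, k < n)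
    if i == 0 then complex.Re (w 0 k) else complex.Im (w 0 k).

Definition singular_triple (R : realType) (m n : nat) (M : 'M[R]_(m, n))
    (s : R) (x : 'cV[R]_m) (y : 'cV[R]_n) : Prop :=
  [/\ 0 <= s, norm2 x = 1, norm2 y = 1, M *m y = s *: x & M^T *m x = s *: y].

Definition top_left_singular_vector (R : realType) (m n : nat)
    (M : 'M[R]_(m, n)) (x : 'cV[R]_m) : Prop :=
  exists s : R,
    (exists y, singular_triple M s x y) /\
    (forall s' x' y', singular_triple M s' x' y' -> s' <= s).

Definition Theta_hat (R : realType) (n : nat) (v : 'cV[R[i]]_n) (omega : R)
    (alpha : 'I_n -> R) (gamma : 'cV[R]_n -> R) (t : R) (u : 'cV[R]_n) :
    'cV[R]_n :=
  \col_k (modc (v k 0) * cos (omega * t + alpha k + gamma u)).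

Definition Omega (R : realType) (omega theta delta t : R) : R :=
  2 * (omega * t + theta) + delta.

Definition Delta (R : realType) (n : nat) (gamma : 'cV[R]_n -> R) (theta : R)
    (u : 'cV[R]_n) : R :=
  2 * (gamma u - theta).

(* Main.v *)
(* With [c = omega t + gamma u], the double-angle formula gives
   2 (|v_k| cos (c + alpha_k))^2 = |v_k|^2 + Re (e^(2ic) v_k^2).  Summing over k,
   the first terms add up to 1 and the second ones to
   Re (e^(2ic) v^T v) = V_j cos (2c + delta_j); the angle theta_j cancels in
   Omega_j + Delta_j. *)
Require Import Defs.
From mathcomp Require Import all_boot all_order all_algebra.
From mathcomp Require Import complex.
From mathcomp Require Import reals trigo.
From mathcomp Require Import ring.

Import Order.TTheory GRing.Theory Num.Theory.
Local Open Scope ring_scope.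
Local Open Scope complex_scope.

Lemma modcM {R : realType} (y z : R[i]) : modc (y * z) = modc y * modc z.
Proof. exact: ComplexField.Normc.normcM. Qed.

Lemma modc_real_ge0 {R : realType} (r : R) : 0 <= r -> modc r%:C = r.
Proof. by move=> r0; rewrite /modc /= expr0n addr0 sqrtr_sqr ger0_norm. Qed.

Lemma sqr_norm2 {R : realType} {m n : nat} (M : 'M[R]_(m, n)) :
  norm2 M ^+ 2 = \sum_i \sum_k M i k ^+ 2.
Proof.
rewrite sqr_sqrtr // sumr_ge0 // => i _.
by rewrite sumr_ge0 // => k _; apply: sqr_ge0.
Qed.

(** A vanishing sum of nonnegative terms vanishes termwise; this is applied first to the rows, then
    to the entries of a row. *)
Lemma cnorm2_eq0 {R : realType} {m n : nat} (M : 'M[R[i]]_(m, n)) :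
  cnorm2 M = 0 -> M = 0.
Proof.
move=> M0; have /eqP := sqr_norm2 (map_mx (@modc R) M).
rewrite -/(cnorm2 M) M0 expr0n eq_sym psumr_eq0 => [/allP sum0|i _]; last first.
  by rewrite sumr_ge0 // => k _; apply: sqr_ge0.
apply/matrixP => i k; have := sum0 i (mem_index_enum i).
rewrite /= psumr_eq0 => [/allP row0|k' _]; last exact: sqr_ge0.
have := row0 k (mem_index_enum k).
by rewrite /= !mxE sqrf_eq0 => /eqP /ComplexField.Normc.eq0_normc.
Qed.

Lemma cnorm2_normalize {R : realType} {m n : nat} (M : 'M[R[i]]_(m, n)) :
  M != 0 -> cnorm2 (normalize M) = 1.
Proof.
move=> M0.
have N0 : cnorm2 M != 0 by apply: contra M0 => /eqP /cnorm2_eq0 ->.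
have N_ge0 : 0 <= cnorm2 M by apply: sqrtr_ge0.
(* Both sides are nonnegative, so squares may be compared; without the root, the scalar factors out
   of the sum. *)
apply/eqP; rewrite -(@eqrXn2 _ 2) ?sqrtr_ge0 ?ler01 // expr1n sqr_norm2.
rewrite (eq_bigr (fun i => (cnorm2 M)^-1 ^+ 2 *
    \sum_k map_mx (@modc R) M i k ^+ 2)) => [|i _]; last first.
  rewrite mulr_sumr; apply: eq_bigr => k _.
  by rewrite !mxE modcM modc_real_ge0 ?invr_ge0 // exprMn.
by rewrite -mulr_sumr -sqr_norm2 -exprMn mulVf // expr1n.
Qed.

(** [invmx V] sends column [a] to a standard basis vector, whose entry [a] is 1. This makes the
    normalized eigenvector a genuine unit vector. *)
Lemma col_unitmx_neq0 {R : comUnitRingType} {n : nat} (V : 'M[R]_n) (a : 'I_n) :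
  V \in unitmx -> col a V != 0.
Proof.
move=> Vu; apply/eqP => Va0; have /matrixP /(_ a 0) : invmx V *m col a V = 0.
  by rewrite Va0 mulmx0.
by rewrite colE mulmxA mulVmx // mul1mx !mxE !eqxx => /eqP; rewrite oner_eq0.
Qed.

Lemma sqr_modc_cosD {R : realType} (z : R[i]) (a c : R) : is_angle z a ->
  (modc z * cos (c + a)) ^+ 2 =
  (modc z ^+ 2 + complex.Re (expi (2 * c) * z ^+ 2)) / 2.
Proof.
move=> za; rewrite [in z ^+ 2]za; move: (modc z) => p.
rewrite mulr_natl mulr2n /expi !expr2 /= !(cosD, sinD).
have := cos2Dsin2 a; have := cos2Dsin2 c.
move: (cos a) (sin a) (cos c) (sin c) => ca sa cc sc hc ha.
(* Inserting both Pythagorean sums, each equal to 1, turns the goal into a polynomial identity in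
   five free variables, which [field] can settle. *)
have -> : p * p = p * p * ((cc ^+ 2 + sc ^+ 2) * (ca ^+ 2 + sa ^+ 2)).
  by rewrite hc ha !mulr1.
by field.
Qed.

Lemma expiD {R : realType} (c d : R) : expi (c + d) = expi c * expi d.
Proof. by rewrite /expi cosD sinD (addrC (sin c * _)). Qed.

Lemma sum_sqr_modc_cosD {R : realType} {n : nat} (v : 'cV[R[i]]_n)
    (alpha : 'I_n -> R) (c : R) : (forall k, is_angle (v k 0) (alpha k)) ->
  \sum_k (modc (v k 0) * cos (c + alpha k)) ^+ 2 =
  (cnorm2 v ^+ 2 + complex.Re (expi (2 * c) * (v^T *m v) 0 0)) / 2.
Proof.
move=> halpha; rewrite sqr_norm2 !mxE mulr_sumr.
(* The real part is additive but not multiplicative, so the phase [expi (2 * c)] has been moved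
   inside the sum beforehand. *)
rewrite (raddf_sum (@complex.Re R : {additive R[i] -> R})).
rewrite -big_split /= mulr_suml; apply: eq_bigr => k _.
by rewrite sqr_modc_cosD // big_ord1 !mxE -expr2.
Qed.

Theorem proposition12 (R : realType) (n : nat) (A : 'M[R]_n)
    (q : nat) (r : 'I_q -> R) (hr : real_parts A r)
    (j : 'I_q) (hj : single_complex A (r j))
    (l : R[i]) (hl : l \in Lambda A (r j)) (hl_pos : 0 < complex.Im l)
    (V : 'M[R[i]]_n) (hV : jordan_basis A V)
    (a b : 'I_n) (hab : unique_longest_block (jordan_form A V) l a b)
    (hconj : conjugate_chain A V l a b)
    (alpha : 'I_n -> R)
    (halpha : forall k : 'I_n, is_angle (vhat V a k 0) (alpha k))
    (gamma : 'cV[R]_n -> R)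
    (hgamma : forall u : 'cV[R]_n, is_angle ((what V b *m cmx u) 0 0) (gamma u))
    (Vj delta : R) (hVj : 0 <= Vj)
    (hdelta : ((vhat V a)^T *m vhat V a) 0 0 = Vj%:C * expi delta)
    (x : 'cV[R]_2) (hx : top_left_singular_vector (re_im_rows (what V b)) x)
    (theta : R) (htheta : is_angle (x 0 0 +i* x 1 0) theta)
    (u : 'cV[R]_n) (t : R) :
  norm2 (Theta_hat (vhat V a) (complex.Im l) alpha gamma t u) =
  Num.sqrt ((1 + Vj * cos (Omega (complex.Im l) theta delta t
                           + Delta gamma theta u)) / 2).
Proof.
have Vu : V \in unitmx by case: hV.
rewrite /norm2; congr Num.sqrt.
(* [addrAC] brings [alpha k] to the end, leaving a phase common to all coordinates in front of
   it. *)
under eq_bigr do rewrite big_ord1 mxE addrAC.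
rewrite sum_sqr_modc_cosD // cnorm2_normalize ?col_unitmx_neq0 // hdelta.
(* With the real factor [Vj] pulled out, the two phases merge and the real part is [Vj] times one
   cosine. *)
rewrite expr1n mulrCA -expiD /= mul0r subr0.
by congr ((1 + _ * cos _) / 2); rewrite /Omega /Delta; ring.
Qed.
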